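(* Let $m\ge 2$ be an integer. Then for all integers $n$ and $k$, $\binom{n}{k}_q\equiv\binom{n_0}{k_0}_q\binom{n'}{k'}\pmod{\Phi_m(q)},$ where $n=n_0+n'm$ and $k=k_0+k'm$ with $n_0,k_0\in\{0,1,\dots,m-1\}$ (and $n',k'$ integers).
   Context: For an integer $n\ge 0$, $(a;q)_n=\prod_{j=0}^{n-1}(1-aq^j)$, and for $n<0$, $(a;q)_n=\prod_{j=1}^{|n|}\frac{1}{1-aq^{-j}}$. For all integers $n,k$, $\binom{n}{k}_q := \lim_{a\to q} \frac{(a;q)_n}{(a;q)_k\,(a;q)_{n-k}}$, a Laurent polynomial in $q$ with integer coefficients; the integer $\binom{n}{k}$ is its value at $q=1$. $\Phi_m(q)$ is the $m$th cyclotomic polynomial. For Laurent polynomials $A(q),B(q)\in\mathbb{Z}[q,q^{-1}]$, $A(q)\equiv B(q)\pmod{\Phi_m(q)}$ means that $A(q)-B(q)$ is divisible by $\Phi_m(q)$ in $\mathbb{Z}[q,q^{-1}]$. *)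

(* Defs.v *)
From HB Require Import structures.
From mathcomp Require Import all_boot all_order all_algebra all_field.
From mathcomp Require Import complex.
From mathcomp Require Import all_classical all_reals all_analysis.
Set Implicit Arguments.
Unset Strict Implicit.
Unset Printing Implicit Defensive.

Import Order.TTheory GRing.Theory Num.Theory.
Import numFieldNormedType.Exports.

Local Open Scope classical_set_scope.
Local Open Scope ring_scope.

Local Notation "x %:F" := (tofrac x).

(* Z[q, q^-1], realized as the localization of Z[q] at the powers of q inside
   its field of fractions. *)
Definition laurent_pred : {pred {fraction {poly int}}} :=
  fun x => `[< exists N (p : {poly int}), x * ('X^N)%:F = p%:F >].

Fact laurent_subring_closed : subring_closed laurent_pred.
Proof.
split=> [|x y|x y].
- by apply/asboolP; exists 0%N, 1; rewrite expr0 mulr1.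
- move=> /asboolP[N [p xp]] /asboolP[M [r yr]]; apply/asboolP.
  exists (N + M)%N, (p * 'X^M - r * 'X^N).
  rewrite exprD rmorphB !rmorphM /= -xp -yr mulrBl mulrA.
  by congr (_ - _); rewrite -mulrA; congr (_ * _); exact: mulrC.
- move=> /asboolP[N [p xp]] /asboolP[M [r yr]]; apply/asboolP.
  by exists (N + M)%N, (p * r); rewrite exprD !rmorphM /= -xp -yr mulrACA.
Qed.

HB.instance Definition _ :=
  GRing.isSubringClosed.Build {fraction {poly int}} laurent_pred
    laurent_subring_closed.

Record laurent := Laurent {
  laurent_val :> {fraction {poly int}};
  _ : laurent_val \in laurent_pred }.

HB.instance Definition _ := [isSub for laurent_val].
HB.instance Definition _ := [Choice of laurent by <:].
HB.instance Definition _ := [SubChoice_isSubComNzRing of laurent by <:].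

Fact laurent_poly_subproof (p : {poly int}) : p%:F \in laurent_pred.
Proof. by apply/asboolP; exists 0%N, p; rewrite expr0 mulr1. Qed.

Definition laurent_poly (p : {poly int}) : laurent :=
  Laurent (laurent_poly_subproof p).

(* A pair (N, p) such that A = q^-N p(q). *)
Definition laurent_repr (A : laurent) : nat * {poly int} :=
  xget (0%N, 0) [set u | laurent_val A * ('X^(u.1))%:F = u.2%:F].

(* The value A(z) at a unit z; it does not depend on the chosen pair, see
   laurent_evalE. *)
Definition laurent_eval (S : comUnitRingType) (z : S) (A : laurent) : S :=
  (map_poly intr (laurent_repr A).2).[z] / z ^+ (laurent_repr A).1.

Lemma laurent_evalE (S : comUnitRingType) (z : S) (A : laurent) N p :
  z \is a GRing.unit -> laurent_val A * ('X^N)%:F = p%:F ->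
  laurent_eval z A = (map_poly intr p).[z] / z ^+ N.
Proof.
move=> uz Ap; rewrite /laurent_eval.
have: laurent_val A * ('X^((laurent_repr A).1))%:F = ((laurent_repr A).2)%:F.
  by have := @xgetI _ (0%N, 0)
    [set u | laurent_val A * ('X^(u.1))%:F = u.2%:F] (N, p) Ap.
case: (laurent_repr A) => M r /= Ar.
have E : r * 'X^N = p * 'X^M.
  apply/eqP; rewrite -tofrac_eq !rmorphM /= -Ar -Ap -!mulrA.
  by apply/eqP; congr (_ * _); exact: mulrC.
have {}E : (map_poly intr r).[z] * z ^+ N = (map_poly intr p).[z] * z ^+ M.
  have := congr1 (fun s => (map_poly intr s).[z]) E.
  by rewrite !rmorphM /= !map_polyXn !hornerM !hornerXn.
apply: (canLR (mulrK _)); first by rewrite unitrX.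
by rewrite mulrAC -E mulrK ?unitrX.
Qed.

Definition laurent_eqmod (D A B : laurent) : Prop := exists C, A - B = D * C.

(* (a; q)_n; note that Negz i is - i.+1. *)
Definition qpoch (K : fieldType) (a q : K) (n : int) : K :=
  match n with
  | Posz i => \prod_(0 <= j < i) (1 - a * q ^+ j)
  | Negz i => \prod_(1 <= j < i.+2) (1 - a * q ^- j)^-1
  end.

Definition qbinom_limit (K : numFieldType) (n k : int) (q v : K) : Prop :=
  qpoch a q n / (qpoch a q k * qpoch a q (n - k)) @[a --> q^'] --> v.

(* The limit is required to be A(q) for generic complex q only: at a root of
   unity q the limit need not be the value of the Laurent polynomial (at q = 1
   the quotient is identically 1 for a != 1), and (a; q)_n is not defined at
   q = 0 when n < 0. *)
Definition is_qbinom (R : realType) (n k : int) (A : laurent) : Prop :=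
  forall q : R[i], q != 0 -> (forall j, (0 < j)%N -> q ^+ j != 1) ->
    qbinom_limit n k q (laurent_eval q A).

(* Such a Laurent polynomial is unique, since generic points are infinitely
   many. *)
Definition qbinom (R : realType) (n k : int) : laurent :=
  xget 0 [set A | is_qbinom R n k A].

Definition binomz (R : realType) (n k : int) : int :=
  laurent_eval (1 : int) (qbinom R n k).

(* Main.v *)
(** For k >= 0 the q-binomial [n, k] of an arbitrary integer n is the unique
    array T(n, k) on Z x N with T(n, 0) = 1, T(0, k + 1) = 0 and the Pascal rule
    T(n + 1, k + 1) = T(n, k) + q^(k+1) T(n, k + 1), since the rule can also be
    run backwards in n.  At a primitive m-th root of unity z the product
    T_z(n0, k0) T_1(n', k') satisfies the same three conditions, because
    T_z(m, k) = 0 for 0 < k < m; this is the congruence evaluated at z, and it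
    suffices because 'Phi_m is the minimal polynomial of z.  For k < 0 the
    q-binomial is T(n, n - k), or 0 if n < k, which reduces to the case k >= 0.
    The limit defining the q-binomial is computed at generic q from the product
    formula T(n, k) * (q; q)_k = (1 - q^n) ... (1 - q^(n-k+1)). *)

From HB Require Import structures.
Require Import Defs.
From mathcomp Require Import all_boot all_order all_algebra all_field.
From mathcomp Require Import complex ring zify.
From mathcomp Require Import all_classical all_reals all_analysis.

Set Implicit Arguments.
Unset Strict Implicit.
Unset Printing Implicit Defensive.

Import Order.TTheory GRing.Theory Num.Theory.
Import numFieldNormedType.Exports.

Local Open Scope classical_set_scope.
Local Open Scope ring_scope.

(** * The q-binomial array over a commutative ring *)

Lemma int_iff_ind (P : int -> Prop) :
  P 0 -> (forall n, P n <-> P (n + 1)) -> forall n, P n.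
Proof.
move=> P0 PS; elim/int_rect => [|n IH|n IH]; first exact: P0.
  by rewrite -addn1 PoszD; exact: (PS n).1.
by apply: (PS _).2; rewrite -addn1 PoszD opprD subrK.
Qed.

Section QBinomial.
Variable S : comNzRingType.

(* The rows n = 0, n + 1 (from row n) and n - 1 (from row n) of the array
   T(n, k), k >= 0; [qi] stands for the inverse of [q]. *)
Definition row0 (k : nat) : S := (k == 0%N)%:R.

Definition row_succ (q : S) (f : nat -> S) (k : nat) : S :=
  if k is k'.+1 then f k' + q ^+ k * f k else 1.

Fixpoint row_pred (qi : S) (f : nat -> S) (k : nat) : S :=
  if k is k'.+1 then qi ^+ k * (f k - row_pred qi f k') else 1.

Definition qbinr (q qi : S) (n : int) : nat -> S :=
  match n with
  | Posz i => iter i (row_succ q) row0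
  | Negz i => iter i.+1 (row_pred qi) row0
  end.

Definition qbinz (q qi : S) (n k : int) : S :=
  match k, n - k with
  | Posz k', _ => qbinr q qi n k'
  | Negz _, Posz l => qbinr q qi n l
  | Negz _, Negz _ => 0
  end.

Variables q qi : S.

Lemma qbinz_neg_sub (n k : int) (l : nat) : k < 0 -> n - k = l%:Z ->
  qbinz q qi n k = qbinr q qi n l.
Proof. by case: k => // k _ E; rewrite /qbinz E. Qed.

Lemma qbinz_neg_lt (n k : int) : k < 0 -> n < k -> qbinz q qi n k = 0.
Proof. by case: k => // k _; rewrite -subr_lt0 /qbinz; case: (n - _). Qed.

Hypothesis qK : q * qi = 1.

Lemma qbinr0 n : qbinr q qi n 0 = 1.
Proof. by case: n => [[|n]|n]. Qed.

Lemma qbinr0S k : qbinr q qi 0 k.+1 = 0.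
Proof. by []. Qed.

Lemma qbinrS n k : qbinr q qi (n + 1) k.+1 =
  qbinr q qi n k + q ^+ k.+1 * qbinr q qi n k.+1.
Proof.
case: n => [n|n]; first by rewrite -PoszD addn1.
have -> : Negz n + 1 = - n%:Z by rewrite NegzE -addn1 PoszD opprD subrK.
have -> : qbinr q qi (- n%:Z) k.+1 = iter n (row_pred qi) row0 k.+1.
  by case: n => [|n]; rewrite ?oppr0 // -NegzE.
rewrite /= mulrA -exprMn qK expr1n mul1r addrC subrK //.
Qed.

(** A column is determined by the previous column and its entry at n = 0: the Pascal rule gives the
    step up in n and, [q] being invertible, also the step down. *)
Lemma qbinr_unique (f : int -> nat -> S) :
  (forall n, f n 0%N = 1) -> (forall k, f 0 k.+1 = 0) ->
  (forall n k, f (n + 1) k.+1 = f n k + q ^+ k.+1 * f n k.+1) ->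
  forall n k, f n k = qbinr q qi n k.
Proof.
move=> f0 f0S fS n k; elim: k n => [|k IH] n; first by rewrite f0 qbinr0.
elim/int_iff_ind: n => [|n]; first by rewrite f0S qbinr0S.
split; first by rewrite fS qbinrS IH => ->.
rewrite fS qbinrS IH => /addrI /(congr1 ( *%R (qi ^+ k.+1))).
by rewrite !mulrA -exprMn mulrC [qi * _]mulrC qK expr1n mul1r mulr1.
Qed.

Lemma qbinr_small n k : (n < k)%N -> qbinr q qi n%:Z k = 0.
Proof.
elim: n k => [|n IH] [|k] //; rewrite ltnS => nk.
by rewrite -addn1 PoszD qbinrS !IH ?mulr0 ?addr0 // ltnS ltnW.
Qed.

End QBinomial.

(** The image of the array satisfies the three conditions over [T], so uniqueness applies. *)
Lemma rmorph_qbinr (S T : comNzRingType) (f : {rmorphism S -> T}) (q qi : S) n k :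
  q * qi = 1 -> f (qbinr q qi n k) = qbinr (f q) (f qi) n k.
Proof.
move=> qK; have fqK : f q * f qi = 1 by rewrite -rmorphM qK rmorph1.
apply: (qbinr_unique fqK (f := fun n k => f (qbinr q qi n k))) => [{}n|{}k|{}n {}k].
- by rewrite qbinr0 rmorph1.
- by rewrite rmorph0.
- by rewrite (qbinrS qK) rmorphD rmorphM rmorphXn.
Qed.

Lemma rmorph_qbinz (S T : comNzRingType) (f : {rmorphism S -> T}) (q qi : S) n k :
  q * qi = 1 -> f (qbinz q qi n k) = qbinz (f q) (f qi) n k.
Proof.
move=> qK; rewrite /qbinz; case: k => k; first exact: rmorph_qbinr.
by case: (n - _) => l; [exact: rmorph_qbinr | exact: rmorph0].
Qed.

(** * Product formula and symmetry over a field *)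

Section Field.
Variables (K : fieldType) (q : K).
Hypothesis q0 : q != 0.

Let qK : q * q^-1 = 1 := divff q0.

(** The symbol (q; q)_k. *)
Definition qfact k : K := \prod_(i < k) (1 - q ^+ i.+1).

Definition qfalling (n : int) k : K := \prod_(i < k) (1 - q ^ (n - i%:Z)).

Lemma qfallingSl n k :
  qfalling (n + 1) k.+1 = (1 - q ^ (n + 1)) * qfalling n k.
Proof.
rewrite /qfalling big_ord_recl subr0; congr (_ * _).
apply: eq_bigr => i _; congr (_ - _ ^ _).
by rewrite /= /bump add1n -addn1 PoszD; ring.
Qed.

(** The difference of the two sides at (n + 1, k + 1) is q^(k+1) times that at (n, k + 1), and it is
    0 at n = 0. Stated without division, the formula also holds at roots of unity. *)
Lemma qbinr_qfact n k : qbinr q q^-1 n k * qfact k = qfalling n k.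
Proof.
elim: k n => [|k IH] n; first by rewrite qbinr0 /qfact /qfalling !big_ord0 mulr1.
elim/int_iff_ind: n => [|n].
  by rewrite qbinr0S mul0r /qfalling big_ord_recl subr0 expr0z subrr mul0r.
have E : qbinr q q^-1 (n + 1) k.+1 * qfact k.+1 - qfalling (n + 1) k.+1 =
  q ^+ k.+1 * (qbinr q q^-1 n k.+1 * qfact k.+1 - qfalling n k.+1).
  rewrite (qbinrS qK) qfallingSl.
  have -> : qfact k.+1 = qfact k * (1 - q ^+ k.+1) by rewrite /qfact big_ord_recr.
  have -> : qfalling n k.+1 = qfalling n k * (1 - q ^ (n - k%:Z)).
    by rewrite /qfalling big_ord_recr.
  (* This gives 1 - q^(n+1) = (1 - q^(k+1)) + q^(k+1) (1 - q^(n-k)). *)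
  have -> : q ^ (n + 1) = q ^+ k.+1 * q ^ (n - k%:Z).
    rewrite -[q ^+ _]/(q ^ k.+1%:Z) -expfzDr //; congr (_ ^ _).
    by rewrite -addn1 PoszD addrCA [k%:Z + 1]addrC addrK.
  rewrite -IH; ring.
split=> /eqP; rewrite -subr_eq0 => H; apply/eqP; rewrite -subr_eq0.
  by rewrite E (eqP H) mulr0.
by move: H; rewrite E mulf_eq0 expf_eq0 (negPf q0) andbF.
Qed.

Lemma qfalling_nat k l : qfalling (k + l)%:Z k * qfact l = qfact (k + l).
Proof.
elim: k l => [|k IH] l; first by rewrite /qfalling big_ord0 mul1r.
rewrite addSn -addn1 PoszD qfallingSl -mulrA IH /qfact addn1 big_ord_recr /= mulrC.
by rewrite -PoszD addn1.
Qed.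

(** Multiplied by [qfact k * qfact l], both sides become [qfact (k + l)], which itself may
    vanish. *)
Lemma qbinr_sym k l : qfact k != 0 -> qfact l != 0 ->
  qbinr q q^-1 (k + l)%:Z k = qbinr q q^-1 (k + l)%:Z l.
Proof.
move=> Fk Fl; apply: (mulIf Fk); apply: (mulIf Fl).
rewrite qbinr_qfact qfalling_nat mulrAC qbinr_qfact.
by rewrite addnC qfalling_nat.
Qed.

End Field.

(** * The Lucas property at a root of unity *)

Section RootOfUnity.
Variables (K : fieldType) (m : nat) (z : K).
Hypothesis prim_z : m.-primitive_root z.

Let m0 : (0 < m)%N := prim_order_gt0 prim_z.

Lemma prim_root_neq0 : z != 0.
Proof.
apply/eqP => z0; have := prim_expr_order prim_z.
by rewrite z0 expr0n gtn_eqF // => /eqP; rewrite eq_sym oner_eq0.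
Qed.

Let zK : z * z^-1 = 1 := divff prim_root_neq0.

Lemma qfact_prim_root_neq0 k : (k < m)%N -> qfact z k != 0.
Proof.
move=> km; apply/prodf_neq0 => i _; rewrite subr_eq0 eq_sym -(prim_order_dvd prim_z).
by rewrite gtnNdvd // (leq_ltn_trans (ltn_ord i)).
Qed.

(** The numerator of the product formula contains 1 - z^m = 0, while its denominator is nonzero for
    k < m. *)
Lemma qbinr_prim_order k : (0 < k < m)%N -> qbinr z z^-1 m%:Z k = 0.
Proof.
case/andP; case: k => // k _ km; apply: (mulIf (qfact_prim_root_neq0 km)).
rewrite (qbinr_qfact prim_root_neq0) mul0r /qfalling big_ord_recl subr0.
by rewrite -exprnP (prim_expr_order prim_z) subrr mul0r.
Qed.

(** Integer division by m > 0 rounds down, so a negative n also has its last digit in 0, ..., m - 1.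
    At q = 1 the array consists of ordinary binomials. *)
Let lucas (n : int) (k : nat) : K :=
  qbinr z z^-1 (n %% m)%Z (k %% m)%N * qbinr 1 1 (n %/ m)%Z (k %/ m)%N.

Let lucasE (n' : int) (n0 k0 k' : nat) : (n0 < m)%N -> (k0 < m)%N ->
  lucas (n0%:Z + n' * m%:Z) (k0 + k' * m)%N =
  qbinr z z^-1 n0%:Z k0 * qbinr 1 1 n' k'.
Proof.
move=> n0m k0m; have mz : m%:Z != 0 by rewrite -lt0n.
have n0z : (0 <= n0%:Z < `|m%:Z|) by rewrite /= ltz_nat.
rewrite /lucas addrC modzMDl modz_small // divzMDl // divz_small // addr0.
by rewrite addnC modnMDl modn_small // divnMDl // divn_small // addn0.
Qed.

(** The right side satisfies the three conditions of [qbinr_unique]; the Pascal rule is checked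
    according to the carries in n + 1 and k + 1. *)
Lemma qbinr_lucas (n' : int) (n0 k0 k' : nat) : (n0 < m)%N -> (k0 < m)%N ->
  qbinr z z^-1 (n0%:Z + n' * m%:Z) (k0 + k' * m)%N =
  qbinr z z^-1 n0%:Z k0 * qbinr 1 1 n' k'.
Proof.
move=> n0m k0m; rewrite -lucasE //; apply/esym/(qbinr_unique zK) => [{}n'|{}k'|].
- by rewrite /lucas mod0n div0n !qbinr0 mulr1.
- rewrite /lucas mod0z div0z [X in _ * qbinr _ _ _ X]/=.
  (* Either the last digit of k + 1 is positive and the first factor vanishes, or m divides k + 1
     and the second one does. *)
  have [E|kd] := posnP (k'.+1 %% m)%N; last first.
    by rewrite qbinr_small ?mul0r.
  rewrite (@qbinr_small _ 1 1) ?mulr1 ?mulr0 // divn_gt0 // dvdn_leq //.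
  exact/eqP.
move=> n k.
have [n1 [n2 [n1m ->]]] : exists n1 : nat, exists n2, (n1 < m)%N /\ n = n1%:Z + n2 * m%:Z.
  have mz : m%:Z != 0 by rewrite -lt0n.
  have /gez0_abs E := modz_ge0 n mz.
  exists `|(n %% m)%Z|%N, (n %/ m)%Z; split; last by rewrite E addrC -divz_eq.
  by rewrite -ltz_nat E ltz_pmod.
rewrite (divn_eq k m) addnC; move: (k %% m)%N (k %/ m)%N (ltn_pmod k m0) => k1 k2 k1m.
rewrite -addSn addrAC -PoszD addn1.
have zX : z ^+ (k1.+1 + k2 * m) = z ^+ k1.+1.
  by rewrite exprD mulnC exprM (prim_expr_order prim_z) expr1n mulr1.
rewrite zX (lucasE n2 k2 n1m k1m).
have n1S : n1.+1%:Z = n1%:Z + 1 by rewrite -addn1 PoszD.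
have [k1Sm|k1Sm] := ltnP k1.+1 m.
  rewrite (lucasE n2 k2 n1m k1Sm).
  have [n1Sm|n1Sm] := ltnP n1.+1 m.
    by rewrite (lucasE n2 k2 n1Sm k1Sm) n1S (qbinrS zK); ring.
  (* Carry in n only: the left side is 0, and the right side is the Pascal expansion of T_z(m, k1 +
     1) = 0 times a common factor. *)
  have n1E : n1.+1 = m by apply/eqP; rewrite eqn_leq n1m.
  have -> : n1.+1%:Z + n2 * m%:Z = 0%:Z + (n2 + 1) * m%:Z by rewrite n1E; ring.
  rewrite (lucasE (n2 + 1) k2 m0 k1Sm) qbinr0S mul0r.
  have := qbinrS zK n1%:Z k1; rewrite -n1S n1E qbinr_prim_order // => /esym E.
  by rewrite mulrA -mulrDl E mul0r.
have k1E : k1.+1 = m by apply/eqP; rewrite eqn_leq k1m.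
have -> : (k1.+1 + k2 * m = 0 + k2.+1 * m)%N by rewrite k1E mulSn.
rewrite (lucasE n2 k2.+1 n1m m0) k1E (prim_expr_order prim_z) qbinr0 !mul1r.
have [n1Sm|n1Sm] := ltnP n1.+1 m.
  (* Carry in k only: T_z(n1, m - 1) = 0 since n1 < m - 1. *)
  rewrite (lucasE n2 k2.+1 n1Sm m0) qbinr0 mul1r qbinr_small ?mul0r ?add0r //.
  by rewrite -ltnS k1E.
(* Two carries: T_z(m - 1, m - 1) = 1, and what remains is the Pascal rule at q = 1. *)
have n1E : n1.+1 = m by apply/eqP; rewrite eqn_leq n1m.
have -> : n1.+1%:Z + n2 * m%:Z = 0%:Z + (n2 + 1) * m%:Z by rewrite n1E; ring.
rewrite (lucasE (n2 + 1) k2.+1 m0 m0) qbinr0 mul1r (qbinrS (mulr1 1)) expr1n mul1r.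
have -> : n1 = (k1 + 0)%N by rewrite addn0; apply: succn_inj; rewrite k1E.
by rewrite (qbinr_sym prim_root_neq0) ?qbinr0 ?mul1r // qfact_prim_root_neq0.
Qed.

(** For k' < 0 and n' >= k', reflect to n - k. Its digits are n0 - k0 and n' - k' if k0 <= n0;
    otherwise there is a borrow and both sides vanish. *)
Lemma qbinz_lucas (n' k' : int) (n0 k0 : nat) : (n0 < m)%N -> (k0 < m)%N ->
  qbinz z z^-1 (n0%:Z + n' * m%:Z) (k0%:Z + k' * m%:Z) =
  qbinz z z^-1 n0%:Z k0%:Z * qbinz 1 1 n' k'.
Proof.
move=> n0m k0m; case: (leP 0 k') => [|k'0].
  by case: k' => // k' _; rewrite -PoszM -PoszD /= qbinr_lucas.
have k0z : k0%:Z + k' * m%:Z < 0 by nia.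
have [n'k'|] := ltP n' k'.
  have : (n' + 1) * m%:Z <= k' * m%:Z by rewrite ler_wpM2r // lezD1.
  move=> le_m; rewrite (qbinz_neg_lt _ _ k'0 n'k') mulr0 qbinz_neg_lt //; lia.
rewrite -subr_ge0; case E : (n' - k') => [d|] // _.
rewrite (qbinz_neg_sub _ _ k'0 E) [X in _ = X * _]/=.
have [kn|nk] := leqP k0 n0.
  rewrite (@qbinz_neg_sub _ _ _ _ _ (n0 - k0 + d * m)%N) //; last first.
    by rewrite PoszD PoszM -E -subzn //; ring.
  rewrite qbinr_lucas ?(leq_ltn_trans (leq_subr _ _)) //; congr (_ * _).
  have nkm : (n0 - k0 < m)%N := leq_ltn_trans (leq_subr _ _) n0m.
  have := qbinr_sym prim_root_neq0 (qfact_prim_root_neq0 k0m)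
    (qfact_prim_root_neq0 nkm).
  by rewrite subnKC.
rewrite [X in _ = X * _](qbinr_small zK) // mul0r.
(* If n' = k', then n < k; otherwise the last digit of n - k is n0 + m - k0 > n0. *)
case: d E => [|d] E.
  by rewrite qbinz_neg_lt //; nia.
rewrite (@qbinz_neg_sub _ _ _ _ _ (n0 + m - k0 + d * m)%N) //; last first.
  have -> : n' = k' + d.+1%:Z by rewrite -E; ring.
  by nia.
by rewrite qbinr_lucas ?(qbinr_small zK) ?mul0r //; lia.
Qed.

End RootOfUnity.

(** * Evaluation of Laurent polynomials *)

Local Notation "x %:F" := (tofrac x).

Lemma laurentP (A : laurent) : exists N p, laurent_val A * ('X^N)%:F = p%:F.
Proof. by case: A => x /= /asboolP. Qed.

Lemma laurent_val_inj (A B : laurent) : laurent_val A = laurent_val B -> A = B.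
Proof. exact: val_inj. Qed.

Lemma tofracXn_neq0 N : ('X^N : {poly int})%:F != 0.
Proof. by rewrite tofrac_eq0 -size_poly_eq0 size_polyXn. Qed.

Lemma laurentXV_subproof : ('X : {poly int})%:F^-1 \in laurent_pred.
Proof.
by apply/asboolP; exists 1%N, 1; rewrite mulVf ?rmorph1 // -['X]expr1 tofracXn_neq0.
Qed.

Definition laurentXV : laurent := Laurent laurentXV_subproof.

Lemma laurentXK : laurent_poly 'X * laurentXV = 1.
Proof. by apply: laurent_val_inj; rewrite /= divff // -['X]expr1 tofracXn_neq0. Qed.

Section Eval.
Variables (S : comUnitRingType) (z : S).
Hypothesis uz : z \is a GRing.unit.

Lemma laurent_eval_poly p : laurent_eval z (laurent_poly p) = (map_poly intr p).[z].
Proof.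
by rewrite (@laurent_evalE _ z _ 0 p) ?expr0 ?divr1 //= rmorph1 mulr1.
Qed.

Lemma laurent_eval_zmod_morphism : zmod_morphism (laurent_eval z).
Proof.
move=> A B; have [N [p Ap]] := laurentP A; have [M [r Br]] := laurentP B.
rewrite (laurent_evalE uz Ap) (laurent_evalE uz Br).
rewrite (@laurent_evalE _ z _ (N + M) (p * 'X^M - r * 'X^N)) //; last first.
  by rewrite exprD rmorphB !rmorphM /= -Ap -Br; ring.
have uzn n : z ^+ n \is a GRing.unit by rewrite unitrX.
rewrite rmorphB !rmorphM /= !map_polyXn hornerD hornerN !hornerM !hornerXn exprD.
rewrite invrM // mulrBl; congr (_ - _).
  by rewrite mulrA mulrK.
by rewrite [z ^- M * _]mulrC mulrA mulrK.
Qed.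

Lemma laurent_eval_monoid_morphism : monoid_morphism (laurent_eval z).
Proof.
split=> [|A B].
  by rewrite (@laurent_evalE _ z _ 0 1) ?rmorph1 ?hornerC ?divr1 //= ?mulr1.
have [N [p Ap]] := laurentP A; have [M [r Br]] := laurentP B.
rewrite (laurent_evalE uz Ap) (laurent_evalE uz Br).
rewrite (@laurent_evalE _ z _ (N + M) (p * r)) //; last first.
  by rewrite exprD !rmorphM /= -Ap -Br; ring.
have uzn n : z ^+ n \is a GRing.unit by rewrite unitrX.
by rewrite rmorphM hornerM exprD invrM // [X in _ * X]mulrC mulrACA.
Qed.

(** The morphism laws rely on [uz], so the structure is a term built from it and not a global
    instance. *)
Definition laurent_eval_rmorphism : {rmorphism laurent -> S} :=
  HB.pack_for {rmorphism laurent -> S} (laurent_eval z)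
    (GRing.isZmodMorphism.Build _ _ (laurent_eval z) laurent_eval_zmod_morphism)
    (GRing.isMonoidMorphism.Build _ _ (laurent_eval z) laurent_eval_monoid_morphism).

Lemma laurent_eval_qbinz n k :
  laurent_eval z (qbinz (laurent_poly 'X) laurentXV n k) = qbinz z z^-1 n k.
Proof.
have eX : laurent_eval_rmorphism (laurent_poly 'X) = z.
  by rewrite /= laurent_eval_poly map_polyX hornerX.
have eXV : laurent_eval_rmorphism laurentXV = z^-1.
  apply: (mulrI uz); rewrite divrr // -{1}eX -rmorphM laurentXK rmorph1 //.
have := rmorph_qbinz laurent_eval_rmorphism n k laurentXK.
by rewrite eX eXV.
Qed.

End Eval.

(** As ['Phi_m] is monic, division with remainder stays in Z[q]; the remainder vanishes at [z] and
    has smaller degree than the minimal polynomial of [z], hence is 0. *)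
Lemma Cyclotomic_dvdp m (z : algC) (p : {poly int}) : m.-primitive_root z ->
  root (map_poly intr p) z -> exists s, p = 'Phi_m * s.
Proof.
move=> prim_z pz; have mPhi := Cyclotomic_monic m.
exists (Pdiv.Ring.rdivp p 'Phi_m); rewrite mulrC.
rewrite {1}(Pdiv.RingMonic.rdivp_eq mPhi p).
set r := Pdiv.Ring.rmodp p _.
suff -> : r = 0 by rewrite addr0.
have rz : root (map_poly ratr (map_poly intr r : {poly rat})) z.
  rewrite -map_poly_comp (eq_map_poly (g := intr)); last first.
    by move=> a /=; rewrite rmorph_int.
  have : map_poly intr p = map_poly intr (Pdiv.Ring.rdivp p 'Phi_m) *
     map_poly intr 'Phi_m + map_poly intr r :> {poly algC}.
    by rewrite -rmorphM -rmorphD -Pdiv.RingMonic.rdivp_eq.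
  move: pz => /[swap] ->; rewrite /root hornerD hornerM.
  rewrite (Cintr_Cyclotomic prim_z) -(minCpoly_cyclotomic prim_z).
  by rewrite (eqP (root_minCpoly z)) mulr0 add0r.
have [d [Dd mon_d] /(_ (map_poly intr r))] := minCpolyP z.
rewrite rz => /esym dr; apply/eqP/negPn/negP => r0.
have size_intr (F : numFieldType) (t : {poly int}) : size (map_poly intr t : {poly F}) = size t.
  by rewrite size_map_inj_poly //; exact: intr_inj.
have r0' : map_poly intr r != 0 :> {poly rat}.
  by rewrite -size_poly_eq0 size_intr size_poly_eq0.
have := dvdp_leq r0' dr; rewrite -(size_map_poly (ratr : rat -> algC)) -Dd.
rewrite (minCpoly_cyclotomic prim_z) -(Cintr_Cyclotomic prim_z) !size_intr leqNgt.
by rewrite Pdiv.Ring.ltn_rmodpN0 // monic_neq0.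
Qed.

(** Clearing the denominator of A - B leaves a polynomial that vanishes at the generic points 2, 3,
    4, ..., hence is 0. *)
Lemma laurent_eq_eval (K : numFieldType) (A B : laurent) :
  (forall q : K, q != 0 -> (forall j, (0 < j)%N -> q ^+ j != 1) ->
     laurent_eval q A = laurent_eval q B) -> A = B.
Proof.
move=> AB; apply/eqP; rewrite -subr_eq0; set C := A - B.
have [N [p Cp]] := laurentP C.
have p_root i : root (map_poly intr p) (i.+2%:R : K).
  have q0 : i.+2%:R != 0 :> K by rewrite pnatr_eq0.
  have uq : (i.+2%:R : K) \is a GRing.unit by rewrite unitfE.
  have /(AB _ q0) E : forall j, (0 < j)%N -> (i.+2%:R : K) ^+ j != 1.
    by move=> j j0; rewrite -natrX pnatr_eq1 gtn_eqF // -{1}(exp1n j) ltn_exp2r.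
  have : laurent_eval (i.+2%:R : K) C = 0.
    by rewrite /C (laurent_eval_zmod_morphism uq) E subrr.
  move/eqP; rewrite (laurent_evalE uq Cp) mulf_eq0 invr_eq0 expf_eq0 (negPf q0) andbF orbF.
  by [].
have p0 : p = 0.
  apply/eqP/negPn/negP => p0.
  have sp : size (map_poly intr p : {poly K}) = size p.
    by rewrite size_map_inj_poly //; exact: intr_inj.
  have := @max_poly_roots K (map_poly intr p) [seq i.+2%:R | i <- iota 0 (size p)].
  rewrite -size_poly_eq0 sp size_poly_eq0 size_map size_iota ltnn => /(_ p0).
  case/(_ _ _)/notF.
    by apply/allP => _ /mapP[i _ ->].
  by rewrite map_inj_uniq ?iota_uniq // => i j /eqP; rewrite eqr_nat => /eqP[].
apply/eqP/laurent_val_inj/eqP; rewrite /= -(mulIr_eq0 _ (mulIf (tofracXn_neq0 N))).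
by rewrite Cp p0 rmorph0.
Qed.

(** * The limit defining the q-binomial coefficients *)

Section Pochhammer.
Variables (K : fieldType) (a q : K).

Lemma qpoch_nat (i : nat) : qpoch a q i%:Z = \prod_(j < i) (1 - a * q ^+ j).
Proof. by rewrite /= big_mkord. Qed.

Lemma qpoch_opp (i : nat) : qpoch a q (- i%:Z) = \prod_(j < i) (1 - a * q ^- j.+1)^-1.
Proof.
case: i => [|i]; first by rewrite oppr0 /= big_nil big_ord0.
by rewrite -NegzE /= big_add1 big_mkord.
Qed.

Variable M : nat.
Hypothesis aq : forall j : int, (`|j| <= M)%N -> 1 - a * q ^ j != 0.

Lemma qpochS (n : int) : (`|n| <= M)%N ->
  qpoch a q (n + 1) = qpoch a q n * (1 - a * q ^ n).
Proof.
case: n => n nM.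
  by rewrite -PoszD addn1 !qpoch_nat big_ord_recr.
have -> : Negz n + 1 = - n%:Z by rewrite NegzE -addn1 PoszD opprD subrK.
by have := aq nM; rewrite NegzE !qpoch_opp big_ord_recr /= -exprnN => /mulfVK->.
Qed.

Lemma qpoch_neq0 (n : int) : (`|n| <= M)%N -> qpoch a q n != 0.
Proof.
case: n => n nM.
  rewrite qpoch_nat; apply/prodf_neq0 => i _; apply: (aq (j := i%:Z)).
  by apply: leq_trans nM; rewrite ltnW // ltn_ord.
rewrite NegzE qpoch_opp; apply/prodf_neq0 => i _; rewrite invr_eq0 exprnN.
by apply: aq; apply: leq_trans nM; rewrite abszN; exact: ltn_ord.
Qed.

(** Whatever the signs of n and n - k, the two symbols differ by k linear factors, in which a can be
    set to q. *)
Lemma qpoch_sub (n : int) k : (`|n| + k <= M)%N -> qpoch a q n =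
  qpoch a q (n - k%:Z) * \prod_(i < k) (1 - a * q ^ (n - 1 - i%:Z)).
Proof.
elim: k => [|k IH] kM; first by rewrite subr0 big_ord0 mulr1.
have E : n - k%:Z = n - k.+1%:Z + 1 by rewrite -addn1 PoszD; ring.
rewrite IH ?E ?qpochS; try lia.
rewrite big_ord_recr /= mulrAC mulrA; congr (_ * (_ - _ * _ ^ _)).
by rewrite -addn1 PoszD; ring.
Qed.

End Pochhammer.

Section Limit.
Variables (K : numFieldType) (q : K).
Hypotheses (q0 : q != 0) (q_gen : forall j, (0 < j)%N -> q ^+ j != 1).

Lemma generic_exprz_neq1 (j : int) : j != 0 -> q ^ j != 1.
Proof.
case: j => [[|j]|j] // _; first exact: q_gen.
by rewrite NegzE -exprnN invr_eq1 q_gen.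
Qed.

Lemma qfact_generic_neq0 k : qfact q k != 0.
Proof. by apply/prodf_neq0 => i _; rewrite subr_eq0 eq_sym q_gen. Qed.

Lemma cvg_linear (c : K) : 1 - a * c @[a --> q^'] --> 1 - q * c.
Proof.
apply: cvgB; first exact: cvg_cst.
by apply: cvgMr_tmp; exact: nbhs_dnbhs.
Qed.

Lemma cvg_prod_linear k (e : 'I_k -> K) :
  \prod_(i < k) (1 - a * e i) @[a --> q^'] --> \prod_(i < k) (1 - q * e i).
Proof.
by apply: cvg_big => [|i _]; [exact: mul_continuous | exact: cvg_linear].
Qed.

(** If q c = 1, the only zero a = q is excluded from the punctured neighbourhood; otherwise
    continuity suffices. *)
Lemma near_linear_neq0 (c : K) : \forall a \near q^', 1 - a * c != 0.
Proof.
have [qc|qc] := eqVneq (q * c) 1; last first.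
  by apply: cvgr_neq0 (@cvg_linear c) _; rewrite subr_eq0 eq_sym.
have c0 : c != 0 by apply: contra_eq_neq qc => ->; rewrite mulr0 eq_sym oner_eq0.
near=> a; rewrite subr_eq0 -qc; apply/eqP => /(mulIf c0) aq.
have : a != q by near: a; exact: nbhs_dnbhs_neq.
by rewrite aq eqxx.
Unshelve. all: by end_near. Qed.

Lemma near_qpoch_generic (M : nat) :
  \forall a \near q^', forall j : int, (`|j| <= M)%N -> 1 - a * q ^ j != 0.
Proof.
(* Shifting by M turns the exponents -M, ..., M into a finite index type, so finitely many
   neighbourhoods are intersected. *)
have : \forall a \near q^', forall i : 'I_(M + M).+1,
    1 - a * q ^ (i%:Z - M%:Z) != 0.
  by apply: filter_forall => i; exact: near_linear_neq0.
apply: filterS => a Ha j jM.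
have iM : (`|(j + M%:Z)%R| < (M + M).+1)%N by lia.
have := Ha (Ordinal iM); rewrite /=; congr (1 - a * q ^ _ != 0); lia.
Qed.

(** Cancelling (a; q)_(n-k) leaves a quotient of products of linear factors in a, whose denominator
    tends to (q; q)_k, nonzero at generic q. *)
Lemma qbinom_limit_nat n k : qbinom_limit n k%:Z q (qbinr q q^-1 n k).
Proof.
have -> : qbinr q q^-1 n k = qfalling q n k / qfact q k.
  by rewrite -(qbinr_qfact q0) mulfK // qfact_generic_neq0.
rewrite /qbinom_limit.
apply: (@cvg_trans _ ((\prod_(i < k) (1 - a * q ^ (n - 1 - i%:Z)) /
                       \prod_(i < k) (1 - a * q ^+ i)) @[a --> q^'])).
  apply: near_eq_cvg.
  apply: filterS (near_qpoch_generic (`|n| + k)) => a Ha.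
  have nk0 : qpoch a q (n - k%:Z) != 0 by apply: (qpoch_neq0 Ha); lia.
  rewrite (qpoch_sub Ha (leqnn _)) -qpoch_nat [qpoch a q k * _]mulrC.
  by rewrite -mulf_div divff // mul1r.
have -> : qfalling q n k = \prod_(i < k) (1 - q * q ^ (n - 1 - i%:Z)).
  apply: eq_bigr => i _; rewrite -{2}[q]expr1z -expfzDr //.
  by congr (_ - _ ^ _); ring.
have -> : qfact q k = \prod_(i < k) (1 - q * q ^+ i).
  by apply: eq_bigr => i _; rewrite exprS.
apply: cvgM; first exact: cvg_prod_linear.
apply: cvgV; last exact: cvg_prod_linear.
by apply/prodf_neq0 => i _; rewrite -exprS subr_eq0 eq_sym q_gen.
Qed.

(** (a; q)_k in the denominator brings 1 - a q^-1 into the numerator, which tends to 0; the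
    remaining denominator tends to a product of factors 1 - q^j with j < 0. *)
Lemma qbinom_limit_neg_lt (n k : int) : k < 0 -> n < k -> qbinom_limit n k q 0.
Proof.
case: k => // c _ nk; rewrite /qbinom_limit.
pose k := c.+1.
have -> : 0 = \prod_(i < k) (1 - q * q ^- i.+1) /
              \prod_(i < k) (1 - q * q ^ (n + k%:Z - 1 - i%:Z)).
  by rewrite big_ord_recl expr1 divff // subrr !mul0r.
apply: (@cvg_trans _ ((\prod_(i < k) (1 - a * q ^- i.+1) /
     \prod_(i < k) (1 - a * q ^ (n + k%:Z - 1 - i%:Z))) @[a --> q^'])).
  apply: near_eq_cvg.
  apply: filterS (near_qpoch_generic (`|(n + k%:Z)%R| + k)) => a Ha.
  have n0 : qpoch a q n != 0 by apply: (qpoch_neq0 Ha); lia.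
  rewrite NegzE opprK (qpoch_sub Ha (leqnn _)) addrK.
  rewrite qpoch_opp prodfV invfM invrK.
  by rewrite invfM mulrCA mulVKf.
apply: cvgM; first exact: cvg_prod_linear.
apply: cvgV; last exact: cvg_prod_linear.
apply/prodf_neq0 => i _; rewrite -{1}[q]expr1z -expfzDr // subr_eq0 eq_sym.
by apply: generic_exprz_neq1; lia.
Qed.

Lemma qbinom_limit_qbinz n k : qbinom_limit n k q (qbinz q q^-1 n k).
Proof.
case: (leP 0 k) => [|k0]; first by case: k => // k _; exact: qbinom_limit_nat.
case E : (n - k) => [l|l]; last first.
  by rewrite qbinz_neg_lt //; [apply: qbinom_limit_neg_lt|]; lia.
rewrite (qbinz_neg_sub _ _ k0 E).
(* The quotient is symmetric under exchanging k and n - k. *)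
have := @qbinom_limit_nat n l; rewrite /qbinom_limit -E subKr.
by apply: cvg_trans; apply: near_eq_cvg; near=> a; rewrite [_ * qpoch a q k]mulrC.
Unshelve. all: by end_near.
Qed.

End Limit.

(** * Identification of the q-binomials and the congruence *)

Lemma qbinomE (R : realType) n k :
  qbinom R n k = qbinz (laurent_poly 'X) laurentXV n k.
Proof.
(* Existence is the limit computed above; uniqueness follows from uniqueness of limits at generic
   q. *)
apply: xget_unique => [q q0 q_gen|A AP].
  rewrite laurent_eval_qbinz ?unitfE //; exact: qbinom_limit_qbinz.
apply: (@laurent_eq_eval (R[i])) => q q0 q_gen.
rewrite laurent_eval_qbinz ?unitfE //.
have := @qbinom_limit_qbinz _ q q0 q_gen n k.
by apply: cvg_unique (AP q q0 q_gen); exact: norm_hausdorff.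
Qed.

Lemma binomzE (R : realType) n k : binomz R n k = qbinz 1 1 n k.
Proof. by rewrite /binomz qbinomE laurent_eval_qbinz ?invr1 ?unitr1. Qed.

(** A - B = q^-N p with p(z) = 0, so ['Phi_m] divides p, and q^-N is a unit. *)
Lemma laurent_eqmod_Cyclotomic m (z : algC) (A B : laurent) :
  m.-primitive_root z -> laurent_eval z A = laurent_eval z B ->
  laurent_eqmod (laurent_poly 'Phi_m) A B.
Proof.
move=> prim_z AB; have uz : z \is a GRing.unit.
  by rewrite unitfE (prim_root_neq0 prim_z).
have [N [p ABp]] := laurentP (A - B).
have [|s ps] := @Cyclotomic_dvdp m z p prim_z.
  have := laurent_eval_zmod_morphism uz A B; rewrite AB subrr.
  rewrite (laurent_evalE uz ABp) => /eqP; rewrite mulf_eq0 invr_eq0 expf_eq0.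
  by rewrite (negPf (prim_root_neq0 prim_z)) andbF orbF.
exists (laurent_poly s * laurentXV ^+ N); apply: laurent_val_inj.
apply: (mulIf (tofracXn_neq0 N)); rewrite ABp ps.
have -> : ('X^N : {poly int})%:F = laurent_val (laurent_poly 'X ^+ N).
  by rewrite rmorphXn; apply/esym/(rmorphXn (val : laurent -> _)).
have valM (U V : laurent) : laurent_val U * laurent_val V = laurent_val (U * V).
  exact/esym/(rmorphM (val : laurent -> _)).
rewrite valM mulrA -mulrA -exprMn [laurentXV * _]mulrC laurentXK expr1n mulr1.
by rewrite -valM -rmorphM.
Qed.

Theorem theorem7p2 (R : realType) (m : nat) (hm : (2 <= m)%N)
    (n k n' k' : int) (n0 k0 : nat)
    (hn0 : (n0 < m)%N) (hk0 : (k0 < m)%N)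
    (hn : n = n0%:Z + n' * m%:Z) (hk : k = k0%:Z + k' * m%:Z) :
  laurent_eqmod (laurent_poly 'Phi_m)
    (qbinom R n k) (qbinom R n0%:Z k0%:Z * (binomz R n' k')%:~R).
Proof.
have [z prim_z] := C_prim_root_exists (ltnW hm).
have uz : z \is a GRing.unit by rewrite unitfE (prim_root_neq0 prim_z).
apply: (laurent_eqmod_Cyclotomic prim_z).
rewrite (laurent_eval_monoid_morphism uz).2 -[laurent_eval z _%:~R]/(laurent_eval_rmorphism uz _).
rewrite rmorph_int !qbinomE binomzE !laurent_eval_qbinz // hn hk.
rewrite (qbinz_lucas prim_z) // (rmorph_qbinz intr) ?mulr1 //.
Qed.
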